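(* Every weak-2-local derivation $\Delta:M_2\to M_2$ is linear and a derivation.
   Context: $M_2$ denotes the C$^*$-algebra of all $2\times 2$ complex matrices. A derivation on a C$^*$-algebra $A$ is a (complex) linear map $D:A\to A$ with $D(ab)=D(a)b+aD(b)$ for all $a,b\in A$. $A^*$ denotes the space of bounded linear functionals on $A$. A (not necessarily linear) mapping $\Delta:A\to A$ is a weak-2-local derivation if for every $a,b\in A$ and every $\phi\in A^*$ there exists a derivation $D_{a,b,\phi}:A\to A$, depending on $a$, $b$ and $\phi$, such that $\phi(\Delta(a))=\phi(D_{a,b,\phi}(a))$ and $\phi(\Delta(b))=\phi(D_{a,b,\phi}(b))$. *)

(* Defs.v *)
From mathcomp Require Import all_boot all_order all_algebra.
From mathcomp Require Import complex classical_sets reals.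

Set Implicit Arguments.
Unset Strict Implicit.
Unset Printing Implicit Defensive.

Import GRing.Theory Num.Theory ComplexField.Normc.
Local Open Scope ring_scope.
Local Open Scope complex_scope.
Local Open Scope classical_set_scope.

Definition euclidean_norm (R : realType) (n : nat) (x : 'cV[R[i]]_n) : R :=
  Num.sqrt (\sum_(j < n) normc (x j 0) ^+ 2).

(* The C*-norm of M_n: the operator norm of the action on C^n with its
   Hilbert space norm. *)
Definition operator_norm (R : realType) (n : nat) (a : 'M[R[i]]_n) : R :=
  sup [set euclidean_norm (a *m x) | x in [set x | euclidean_norm x <= 1]].

Definition is_derivation (R : realType) (A : algType R[i]) (D : A -> A) : Prop :=
  linear D /\ forall a b : A, D (a * b) = D a * b + a * D b.

(* [A] enters as an algebra together with its C*-norm [N]; the involution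
   plays no role in the notions below. *)
Definition bounded_functional (R : realType) (A : algType R[i]) (N : A -> R)
    (phi : A -> R[i]) : Prop :=
  scalar phi /\ exists M : R, forall a : A, normc (phi a) <= M * N a.

Definition weak_2_local_derivation (R : realType) (A : algType R[i])
    (N : A -> R) (Delta : A -> A) : Prop :=
  forall (a b : A) (phi : A -> R[i]), bounded_functional N phi ->
  exists D : A -> A, [/\ is_derivation D,
    phi (Delta a) = phi (D a) & phi (Delta b) = phi (D b)].

(* Main.v *)
From HB Require Import structures.
Require Import Defs.
From mathcomp Require Import all_boot all_order all_algebra.
From mathcomp Require Import complex reals.
From mathcomp Require Import classical_sets ring.

(** The bilinear form [tr (a * b)] on matrices is nondegenerate, and every
derivation [D] is skew for it, because [D] is a commutator [[z, .]] and
[tr (a * [z, b]) = - tr (b * [z, a])].  The point is that a weak-2-local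
derivation inherits this skewness without being assumed linear: apply the
hypothesis to the pair [a], [b] with the functional [tr ((a + b) * .)].  The
local derivation [D] then gives

   [tr ((a + b) * (Delta a + Delta b)) = tr ((a + b) * D (a + b)) = 0],

and since also [tr (a * Delta a) = 0] and [tr (b * Delta b) = 0], what remains
is [tr (a * Delta b) + tr (b * Delta a) = 0].

Skewness says that [Delta] is its own negative adjoint, which determines all
its values from those on the matrix units.  Since moreover [Delta 1 = 0], what
is left is a skew endomorphism of the three-dimensional space [sl_2] with its
trace form, that is an element of [so_3], and [so_3 = ad sl_2].  Hence
[Delta = [z, .]] for some matrix [z] ([trace_skew_inner]), which makes it linear
and a derivation at once. *)

Set Implicit Arguments.
Unset Strict Implicit.
Unset Printing Implicit Defensive.

Import Order.TTheory GRing.Theory Num.Theory ComplexField.Normc.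
Local Open Scope ring_scope.
Local Open Scope complex_scope.
Local Open Scope classical_set_scope.

(** * Derivations of matrix algebras and the trace form *)

Lemma mxtrace_delta_mul (F : comNzRingType) (n : nat) (i j : 'I_n.+1)
    (x : 'M[F]_n.+1) : \tr (delta_mx i j * x) = x j i.
Proof.
rewrite -mulmxE /mxtrace (bigD1 i) //= big1 ?addr0 => [|k ki].
  rewrite mxE (bigD1 j) //= big1 ?addr0 => [|l lj].
    by rewrite mxE !eqxx mul1r.
  by rewrite mxE (negPf lj) andbF mul0r.
rewrite mxE big1 // => l _.
by rewrite mxE (negPf ki) mul0r.
Qed.

(** The implementing element is [z = \sum_i D E_i0 * E_0i]: by the Leibniz rule
[x * z] is the sum of the [D (x * E_i0) * E_0i] minus [D x * \sum_i E_ii = D x],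
and that sum is [z * x], as both expand to the sum of the
[x k i *: (D E_k0 * E_0i)]. *)
Lemma matrix_derivation_inner (F : comNzRingType) (n : nat)
    (D : 'M[F]_n.+1 -> 'M[F]_n.+1) :
    linear D -> (forall a b : 'M[F]_n.+1, D (a * b) = D a * b + a * D b) ->
  exists z, forall x, D x = z * x - x * z.
Proof.
move=> linD derD.
pose D' : {linear 'M[F]_n.+1 -> 'M[F]_n.+1} :=
  HB.pack D (GRing.isLinear.Build _ _ _ _ D linD).
have D'E x : D x = D' x by [].
pose z : 'M[F]_n.+1 := \sum_i D (delta_mx i 0) * delta_mx 0 i.
exists z => x.
have sumE : \sum_i delta_mx i 0 * delta_mx 0 i = 1 :> 'M[F]_n.+1.
  rewrite -[RHS]/(1%:M) scalar_mx_sum_delta.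
  apply: eq_bigr => i _.
  by rewrite -mulmxE mul_delta_mx scale1r.
have xzE : x * z = \sum_i D (x * delta_mx i 0) * delta_mx 0 i - D x.
  rewrite -[X in _ - X]mulr1 -sumE [in RHS]mulr_sumr -sumrB /z mulr_sumr.
  apply: eq_bigr => i _.
  by rewrite derD mulrDl !mulrA addrAC subrr add0r.
suff -> : z * x = \sum_i D (x * delta_mx i 0) * delta_mx 0 i.
  by rewrite xzE subKr.
have colE i : x * delta_mx i 0 = \sum_k x k i *: delta_mx k 0 :> 'M[F]_n.+1.
  rewrite {1}[x]matrix_sum_delta mulr_suml; apply: eq_bigr => k _.
  rewrite mulr_suml (bigD1 i) //= [X in _ + X]big1 ?addr0 => [|l li].
    by rewrite -scalerAl -mulmxE mul_delta_mx.
  by rewrite -scalerAl -mulmxE mul_delta_mx_0 ?scaler0.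
have rowE k : delta_mx 0 k * x = \sum_i x k i *: delta_mx 0 i :> 'M[F]_n.+1.
  rewrite {1}[x]matrix_sum_delta mulr_sumr (bigD1 k) //= [X in _ + X]big1 ?addr0.
    rewrite mulr_sumr; apply: eq_bigr => i _.
    by rewrite -scalerAr -mulmxE mul_delta_mx.
  move=> l lk; rewrite mulr_sumr big1 // => i _.
  by rewrite -scalerAr -mulmxE mul_delta_mx_0 ?scaler0 // eq_sym.
transitivity (\sum_k \sum_i x k i *: (D (delta_mx k 0) * delta_mx 0 i)).
  rewrite /z mulr_suml; apply: eq_bigr => k _.
  rewrite -mulrA rowE mulr_sumr; apply: eq_bigr => i _.
  by rewrite scalerAr.
rewrite exchange_big; apply: eq_bigr => i _.
rewrite colE D'E linear_sum mulr_suml; apply: eq_bigr => k _.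
by rewrite linearZ /= scalerAl.
Qed.

Lemma derivation_trace_alternating (F : comNzRingType) (n : nat)
    (D : 'M[F]_n.+1 -> 'M[F]_n.+1) (a : 'M[F]_n.+1) :
    linear D -> (forall a b : 'M[F]_n.+1, D (a * b) = D a * b + a * D b) ->
  \tr (a * D a) = 0.
Proof.
move=> linD derD; have [z ->] := matrix_derivation_inner linD derD.
by rewrite mulrBr linearB /= !mulrA -!mulmxE mxtrace_mulC mulmxA subrr.
Qed.

(** * Trace-skew maps on two by two matrices *)

(** Matching [z * E_ij - E_ij * z] with [Delta E_ij] forces
[z 0 1 = - Delta E_00 0 1], [z 1 0 = Delta E_00 1 0] and
[z 0 0 - z 1 1 = Delta E_01 0 1]; [z] is only defined up to a scalar matrix,
which is fixed by [z 1 1 = 0].  The other entries of the [Delta E_ij] follow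
from these three by skewness. *)
Lemma trace_skew_inner (F : comNzRingType) (Delta : 'M[F]_2 -> 'M[F]_2) :
    Delta 1 = 0 -> (forall a, \tr (a * Delta a) = 0) ->
    (forall a b, \tr (a * Delta b) = - \tr (b * Delta a)) ->
  exists z, forall x, Delta x = z * x - x * z.
Proof.
move=> Delta1 alt skew.
have lift01 : lift ord0 ord0 = 1 :> 'I_2 by apply: val_inj.
have two (P : 'I_2 -> Prop) : P 0 -> P 1 -> forall i, P i.
  by move=> P0 P1 i; case: (unliftP 0 i) => [j|] -> //; rewrite ord1 lift01.
have mulE (x y : 'M[F]_2) i j : (x * y) i j = x i 0 * y 0 j + x i 1 * y 1 j.
  by rewrite -mulmxE !mxE !big_ord_recl big_ord0 addr0 lift01.
have trM (x y : 'M[F]_2) : \tr (x * y) =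
    x 0 0 * y 0 0 + x 0 1 * y 1 0 + (x 1 0 * y 0 1 + x 1 1 * y 1 1).
  by rewrite /mxtrace !big_ord_recl big_ord0 addr0 lift01 !mulE.
pose e i j : 'M[F]_2 := delta_mx i j.
have entry a i j : Delta a i j = - \tr (a * Delta (e j i)).
  by rewrite -mxtrace_delta_mul skew.
have diag i j : Delta (e i j) j i = 0 by rewrite -mxtrace_delta_mul alt.
have swap i j k l : Delta (e i j) k l = - Delta (e l k) j i.
  by rewrite entry mxtrace_delta_mul.
have tr0 x : \tr (Delta x) = 0.
  by rewrite -[Delta x]mul1r skew Delta1 mulr0 linear0 oppr0.
have sum0 (i j : 'I_2) : Delta (e 1 1) i j = - Delta (e 0 0) i j.
  have e11 : e 1 1 = 1 - e 0 0.
    by apply/matrixP; elim/two; elim/two; rewrite !mxE /= ?subrr ?subr0.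
  rewrite !entry e11 mulrBl mul1r linearB /= opprB opprK.
  by rewrite tr0 subr0.
pose p := Delta (e 0 0) 0 1; pose q := Delta (e 0 0) 1 0.
pose t := Delta (e 0 1) 0 1.
pose z : 'M[F]_2 := t *: e 0 0 - p *: e 0 1 + q *: e 1 0.
exists z => x.
have Delta00 : Delta (e 0 0) = p *: e 0 1 + q *: e 1 0.
  have h11 : Delta (e 0 0) 1 1 = 0.
    by apply: oppr_inj; rewrite -sum0 diag oppr0.
  apply/matrixP; elim/two; elim/two; rewrite !mxE /= ?diag ?h11 -/p -/q; ring.
have Delta11 : Delta (e 1 1) = - (p *: e 0 1 + q *: e 1 0).
  by rewrite -Delta00; apply/matrixP => i j; rewrite sum0 !mxE.
have Delta01 : Delta (e 0 1) = t *: e 0 1 - q *: e 0 0 + q *: e 1 1.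
  apply/matrixP; elim/two; elim/two; rewrite !mxE /= ?diag -/t;
    rewrite ?(swap _ _ 0 0) ?(swap _ _ 1 1) ?Delta00 ?Delta11 ?mxE /=; ring.
have Delta10 : Delta (e 1 0) = - t *: e 1 0 - p *: e 0 0 + p *: e 1 1.
  apply/matrixP; elim/two; elim/two; rewrite !mxE /= ?diag;
    rewrite ?(swap _ _ 0 0) ?(swap _ _ 1 1) ?(swap _ _ 1 0) ?Delta00 ?Delta11 ?mxE /= -/t; ring.
apply/matrixP => i j; rewrite entry trM [RHS]mxE [X in _ = _ + X]mxE !mulE.
elim/two: i; elim/two: j;
  rewrite ?Delta00 ?Delta01 ?Delta10 ?Delta11;
  rewrite !mxE /=; ring.
Qed.

(** * Continuity of the trace functionals *)

Lemma normc_ge0 (R : realType) (x : R[i]) : 0 <= normc x.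
Proof. by case: x => a b; apply: sqrtr_ge0. Qed.

Lemma normc_sum_le (R : realType) (I : finType) (f : I -> R[i]) :
  normc (\sum_i f i) <= \sum_i normc (f i).
Proof.
elim/big_ind2: _ => [|x y u v xy uv|//]; first by rewrite normc0.
by rewrite (le_trans (le_normcD _ _)) // lerD.
Qed.

Lemma entry_le_euclidean_norm (R : realType) (n : nat) (x : 'cV[R[i]]_n)
    (j : 'I_n) : normc (x j 0) <= euclidean_norm x.
Proof.
rewrite -[leLHS]ger0_norm ?normc_ge0 // -sqrtr_sqr ler_wsqrtr //.
by rewrite (bigD1 j) //= lerDl sumr_ge0 // => k _; rewrite exprn_ge0 ?normc_ge0.
Qed.

(** The supremum defining the operator norm is over a bounded set: on the unit
ball the coordinate [i] of [a *m x] is at most the sum of the moduli of row [i].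
Evaluating at a basis vector then bounds the entries of [a]. *)
Lemma entry_le_operator_norm (R : realType) (n : nat) (a : 'M[R[i]]_n)
    (i j : 'I_n) : normc (a i j) <= operator_norm a.
Proof.
pose u : 'cV[R[i]]_n := delta_mx j 0.
have -> : a i j = (a *m u) i 0.
  by rewrite -colE mxE.
apply: le_trans (entry_le_euclidean_norm _ _) _.
apply: ub_le_sup.
  exists (Num.sqrt (\sum_k (\sum_l normc (a k l)) ^+ 2)) => _ [x /= x1 <-].
  apply/ler_wsqrtr/ler_sum => k _.
  rewrite lerXn2r ?nnegrE ?normc_ge0 ?sumr_ge0 // => [l _|]; first exact: normc_ge0.
  rewrite mxE (le_trans (normc_sum_le _)) // ler_sum // => l _.
  rewrite normcM ler_piMr ?normc_ge0 //.
  exact: le_trans (entry_le_euclidean_norm _ _) x1.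
exists u => //=.
rewrite /euclidean_norm (bigD1 j) //= big1 ?addr0 => [|k kj].
  by rewrite mxE !eqxx normc1 expr1n sqrtr1.
by rewrite mxE (negPf kj) normc0 expr0n.
Qed.

Lemma bounded_trace_functional (R : realType) (n : nat) (c : 'M[R[i]]_n.+1) :
  bounded_functional (@operator_norm R n.+1) (fun x => \tr (c * x)).
Proof.
split=> [k x y|]; first by rewrite mulrDr -scalerAr linearP.
exists (\sum_i \sum_j normc (c i j)) => a.
rewrite (le_trans (normc_sum_le _)) // mulr_suml ler_sum // => i _.
rewrite -mulmxE mxE (le_trans (normc_sum_le _)) // mulr_suml ler_sum // => j _.
by rewrite normcM ler_wpM2l ?normc_ge0 // entry_le_operator_norm.
Qed.

(** * Weak-2-local derivations *)

Section WeakTwoLocal.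

Variables (R : realType) (n : nat) (Delta : 'M[R[i]]_n.+1 -> 'M[R[i]]_n.+1).
Hypothesis hDelta : weak_2_local_derivation (@operator_norm R n.+1) Delta.

Lemma weak_2_local_derivation_trace_alternating (a : 'M[R[i]]_n.+1) :
  \tr (a * Delta a) = 0.
Proof.
have [D [[linD derD] -> _]] := hDelta a a (bounded_trace_functional a).
exact: derivation_trace_alternating.
Qed.

(** Testing [a] and [b] against their own sum makes additivity of the local
derivation stand in for additivity of [Delta]. *)
Lemma weak_2_local_derivation_trace_skew (a b : 'M[R[i]]_n.+1) :
  \tr (a * Delta b) = - \tr (b * Delta a).
Proof.
have [D [[linD derD] Da Db]] := hDelta a b (bounded_trace_functional (a + b)).
have Dab : D (a + b) = D a + D b.
  by have := linD 1 a b; rewrite !scale1r.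
have : \tr ((a + b) * Delta a) + \tr ((a + b) * Delta b) = 0.
  rewrite Da Db -linearD -mulrDr -Dab.
  exact: derivation_trace_alternating.
rewrite !mulrDl !linearD /= !weak_2_local_derivation_trace_alternating.
by rewrite add0r addr0 addrC => /eqP; rewrite addr_eq0 => /eqP.
Qed.

Lemma weak_2_local_derivation1 : Delta 1 = 0.
Proof.
apply/matrixP => i j; rewrite -mxtrace_delta_mul mxE.
have [D [[_ derD] -> _]] := hDelta 1 1 (bounded_trace_functional (delta_mx j i)).
suff -> : D 1 = 0 by rewrite mulr0 linear0.
by apply: (addrI (D 1)); rewrite addr0 -{3}[1]mulr1 derD mulr1 mul1r.
Qed.

End WeakTwoLocal.

Theorem theorem3p2 (R : realType) (Delta : 'M[R[i]]_2 -> 'M[R[i]]_2)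
    (hDelta : weak_2_local_derivation (@operator_norm R 2) Delta) :
  is_derivation Delta.
Proof.
have [z DeltaE] := trace_skew_inner (weak_2_local_derivation1 hDelta)
  (weak_2_local_derivation_trace_alternating hDelta)
  (weak_2_local_derivation_trace_skew hDelta).
split=> [k x y|x y]; rewrite !DeltaE.
  by rewrite mulrDr mulrDl -scalerAr -scalerAl scalerBr opprD addrACA.
by rewrite mulrBl mulrBr !mulrA addrA subrK.
Qed.
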